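(* Let $\mathbf{\Sigma}=\{\Sigma_t=(\mathbf{x}_t,B_t)\}_{t\in\mathbb{T}_n}$ be a cluster pattern of rank $n\ge 1$ and let $\mathcal{A}$ be the associated cluster algebra. Assume $\mathcal{A}$ is of finite mutation type, i.e. the set $\{B_t\mid t\in\mathbb{T}_n\}$ is finite. Then the cluster automorphism group $\operatorname{Aut}(\mathcal{A})$ is finitely generated.
   Context: Write $[b]_+=\max(b,0)$. Let $\mathcal{F}$ be the field of rational functions in $n$ variables over $\mathbb{Q}$. An integer $n\times n$ matrix $B$ is skew-symmetrizable if there is a diagonal matrix $D$ with positive integer diagonal entries such that $(DB)^T=-DB$. A labeled seed of rank $n$ in $\mathcal{F}$ is a pair $\Sigma=(\mathbf{x},B)$ where $\mathbf{x}=(x_1,\dots,x_n)$ (the cluster) is a transcendence basis of $\mathcal{F}$ over $\mathbb{Q}$ (as usual, generating $\mathcal F$ as a field) and $B=(b_{ij})$ (the exchange matrix) is an $n\times n$ skew-symmetrizable integer matrix. For $k\in\{1,\dots,n\}$ the mutation $\mu_k(\Sigma)=(\mathbf{x}',B')$ is the labeled seed with $x'_i=x_i$ for $i\ne k$, $x'_k=x_k^{-1}\left(\prod_{j}x_j^{[b_{jk}]_+}+\prod_j x_j^{[-b_{jk}]_+}\right)$, and $b'_{ij}=-b_{ij}$ if $i=k$ or $j=k$, $b'_{ij}=b_{ij}+b_{ik}[b_{kj}]_++[-b_{ik}]_+b_{kj}$ otherwise. We write $\mu_k(\mathbf{x})$ for the cluster of $\mu_k(\Sigma)$. $\mathbb{T}_n$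 is the $n$-regular tree with edges labeled by $1,\dots,n$ so that the $n$ edges at each vertex have distinct labels. A cluster pattern of rank $n$ is a family $\mathbf{\Sigma}=\{\Sigma_t=(\mathbf{x}_t,B_t)\}_{t\in\mathbb{T}_n}$ of labeled seeds, indexed by the vertices, such that $\Sigma_{t'}=\mu_k(\Sigma_t)$ whenever $t,t'$ are joined by an edge labeled $k$. Write $\mathbf{x}_t=(x_{1;t},\dots,x_{n;t})$. The associated cluster algebra $\mathcal{A}$ is the $\mathbb{Z}$-subalgebra of $\mathcal{F}$ generated by all cluster variables $x_{i;t}$. For $\sigma\in S_n$: $\sigma\mathbf{x}=(x_{\sigma^{-1}(1)},\dots,x_{\sigma^{-1}(n)})$. A $\mathbb{Z}$-algebra automorphism $f$ of $\mathcal{A}$ is a cluster automorphism if there exist seeds $\Sigma=(\mathbf{x},B),\Sigma'=(\mathbf{x}',B')$ in $\mathbf{\Sigma}$ and $\sigma\in S_n$ with $\sigma(f(\mathbf{x}))=\mathbf{x}'$ and $\sigma(f(\mu_k(\mathbf{x})))=\mu_{\sigma(k)}(\mathbf{x}')$ for all $k\in\{1,\dots,n\}$ ($f$ applied entrywise). The cluster automorphisms form a group $\operatorname{Aut}(\mathcal{A})$ under composition. *)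

(* Defs.v *)
From HB Require Import structures.
From mathcomp Require Import all_boot all_order all_fingroup all_algebra.
From mathcomp Require Import fraction.
From mathcomp.multinomials Require Import mpoly.
From mathcomp.classical Require Import boolp classical_sets cardinality.

Set Implicit Arguments.
Unset Strict Implicit.
Unset Printing Implicit Defensive.

Import Order.TTheory GRing.Theory Num.Theory.
Local Open Scope ring_scope.

Notation ratfun n := {fraction {mpoly rat[n]}}.

Definition ratfun_const (n : nat) (c : rat) : ratfun n :=
  tofrac (c%:MP : {mpoly rat[n]}).

Definition cluster (n : nat) := {ffun 'I_n -> ratfun n}.

(* [mmap (ratfun_const n) x p] is the value of [p] at [x]. *)
Definition alg_independent (n : nat) (x : cluster n) : Prop :=
  forall p : {mpoly rat[n]}, mmap (@ratfun_const n) x p = 0 -> p = 0.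

(* No condition on constants is needed: every subfield contains the rationals.
   Together with [alg_independent] this makes [x] a transcendence basis. *)
Definition generates_field (n : nat) (x : cluster n) : Prop :=
  forall K : {pred ratfun n}, divring_closed K ->
    (forall i, x i \in K) -> forall z, z \in K.

Definition skew_symmetrizable (n : nat) (B : 'M[int]_n) : Prop :=
  exists d : 'rV[int]_n,
    (forall i, 0 < d 0 i) /\ (diag_mx d *m B)^T = - (diag_mx d *m B).

Record seed (n : nat) := Seed { clus : cluster n; exmx : 'M[int]_n }.

Definition is_labeled_seed (n : nat) (S : seed n) : Prop :=
  [/\ alg_independent (clus S), generates_field (clus S)
    & skew_symmetrizable (exmx S)].

Definition posp (b : int) : int := Num.max b 0.

Definition mut_clus (n : nat) (k : 'I_n) (S : seed n) : cluster n :=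
  let x := clus S in let B := exmx S in
  [ffun i => if i == k then
      (x k)^-1 * (\prod_j x j ^ posp (B j k) + \prod_j x j ^ posp (- B j k))
    else x i].

Definition mut_exmx (n : nat) (k : 'I_n) (B : 'M[int]_n) : 'M[int]_n :=
  \matrix_(i, j)
    if (i == k) || (j == k) then - B i j
    else B i j + B i k * posp (B k j) + posp (- B i k) * B k j.

Definition mutation (n : nat) (k : 'I_n) (S : seed n) : seed n :=
  Seed (mut_clus k S) (mut_exmx k (exmx S)).

(* The n-regular tree: vertices are the words in the labels without two equal
   consecutive letters, and an edge labeled [k] joins [w] to [k :: w]. *)

Definition reduced (n : nat) (w : seq 'I_n) : bool :=
  sorted (fun i j => i != j) w.

Definition treeT (n : nat) := {w : seq 'I_n | reduced w}.

Definition tedge (n : nat) (k : 'I_n) (t t' : treeT n) : bool :=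
  (val t' == k :: val t) || (val t == k :: val t').

Lemma tedge_unique (n : nat) (k : 'I_n) (t : treeT n) :
  exists! t' : treeT n, tedge k t t'.
Proof.
case: t => -[|j w] tP.
  exists (Sub [:: k] isT); split=> [|[u uP]]; first by rewrite /tedge /= eqxx.
  by rewrite /tedge /= orbF => /eqP uE; apply: val_inj; rewrite /= uE.
case: (eqVneq j k) => [jk|jk].
  subst j; have wP : reduced w by apply: path_sorted tP.
  exists (Sub w wP); split=> [|[u uP]]; first by rewrite /tedge /= eqxx orbT.
  rewrite /tedge /= => /orP[/eqP uE|/eqP[uE]]; last exact: val_inj.
  by exfalso; move: uP; rewrite uE /reduced /= eqxx.
have kP : reduced (k :: j :: w) by rewrite /reduced /= eq_sym jk; exact: tP.
exists (Sub _ kP); split=> [|[u uP]]; first by rewrite /tedge /= eqxx.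
rewrite /tedge /= => /orP[/eqP uE|/eqP[jE _]]; first exact: val_inj.
by rewrite jE eqxx in jk.
Qed.

Record cluster_pattern (n : nat) := ClusterPattern {
  seed_at :> treeT n -> seed n;
  seed_atP : forall t, is_labeled_seed (seed_at t);
  seed_at_edge : forall (k : 'I_n) (t t' : treeT n),
    tedge k t t' -> seed_at t' = mutation k (seed_at t)
}.

Definition finite_mutation_type (n : nat) (S : cluster_pattern n) : Prop :=
  finite_set [set exmx (S t) | t in [set: treeT n]]%classic.

Definition cluster_alg_pred (n : nat) (S : cluster_pattern n) :
    {pred ratfun n} :=
  fun z => `[< forall K : {pred ratfun n}, subring_closed K ->
               (forall t i, clus (S t) i \in K) -> z \in K >].

Lemma cluster_alg_subring n (S : cluster_pattern n) :
  subring_closed (cluster_alg_pred S).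
Proof.
split=> [|u v /asboolP uA /asboolP vA|u v /asboolP uA /asboolP vA];
  apply/asboolP => K Kring KS.
- by case: Kring.
- by case: (Kring) => _ KB _; apply: KB; [apply: uA | apply: vA].
- by case: (Kring) => _ _ KM; apply: KM; [apply: uA | apply: vA].
Qed.

HB.instance Definition _ n (S : cluster_pattern n) :=
  GRing.isSubringClosed.Build (ratfun n) (cluster_alg_pred S)
    (cluster_alg_subring S).

Record cluster_alg (n : nat) (S : cluster_pattern n) := ClusterAlg {
  clalg_val : ratfun n;
  clalg_valP : clalg_val \in cluster_alg_pred S
}.

HB.instance Definition _ n (S : cluster_pattern n) :=
  [isSub for @clalg_val n S].
HB.instance Definition _ n (S : cluster_pattern n) :=
  [Choice of cluster_alg S by <:].
HB.instance Definition _ n (S : cluster_pattern n) :=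
  [SubChoice_isSubComNzRing of cluster_alg S by <:].

Lemma clus_in_alg n (S : cluster_pattern n) t i :
  clus (S t) i \in cluster_alg_pred S.
Proof. by apply/asboolP => K _; apply. Qed.

Lemma mut_clus_in_alg n (S : cluster_pattern n) k t i :
  mut_clus k (S t) i \in cluster_alg_pred S.
Proof.
have [t' [tt' _]] := tedge_unique k t.
have := clus_in_alg S t' i.
by rewrite (seed_at_edge _ tt').
Qed.

Record ring_aut (R : nzRingType) := RingAut {
  ring_aut_fun :> {rmorphism R -> R};
  ring_aut_bij : bijective ring_aut_fun
}.

HB.instance Definition _ (R : nzRingType) := gen_eqMixin (ring_aut R).
HB.instance Definition _ (R : nzRingType) := gen_choiceMixin (ring_aut R).

Section RingAutGroup.
Variable R : nzRingType.
Implicit Types f g h : ring_aut R.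

Lemma ring_autP f g : f =1 g -> f = g.
Proof.
case: f g => [f f_bij] [g g_bij] /= fg.
have {}fg : f = g.
  case: f g fg {f_bij g_bij} => [f fC] [g gC] /= /funext fg.
  subst g; congr GRing.RMorphism.Pack.
  case: fC gC => [[fD] [fM]] [[gD] [gM]].
  by rewrite (Prop_irrelevance fD gD) (Prop_irrelevance fM gM).
by subst g; congr RingAut; apply: Prop_irrelevance.
Qed.

Definition ring_aut1 : ring_aut R :=
  @RingAut R idfun (Bijective (frefl _) (frefl _)).

Definition ring_autM f g : ring_aut R :=
  @RingAut R (f \o g) (bij_comp (ring_aut_bij f) (ring_aut_bij g)).

Lemma ring_autV_exists f :
  exists g : ring_aut R, cancel f g /\ cancel g f.
Proof.
have [g fK gK] := ring_aut_bij f.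
have gB : zmod_morphism g by apply: can2_zmod_morphism fK gK.
have gM : monoid_morphism g by apply: can2_monoid_morphism fK gK.
pose gA := GRing.isZmodMorphism.Build R R g gB.
pose gR := GRing.isMonoidMorphism.Build R R g gM.
pose g' : {rmorphism R -> R} := HB.pack g gA gR.
by exists (@RingAut R g' (Bijective gK fK)).
Qed.

Definition ring_autV f : ring_aut R := projT1 (cid (ring_autV_exists f)).

Lemma ring_autMA : associative ring_autM.
Proof. by move=> f g h; apply: ring_autP. Qed.

Lemma ring_aut1M : left_id ring_aut1 ring_autM.
Proof. by move=> f; apply: ring_autP. Qed.

Lemma ring_autM1 : right_id ring_aut1 ring_autM.
Proof. by move=> f; apply: ring_autP. Qed.

Lemma ring_autVM : left_inverse ring_aut1 ring_autV ring_autM.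
Proof.
move=> f; apply: ring_autP => x /=.
by rewrite /ring_autV; case: cid => g [/= fK _]; apply: fK.
Qed.

Lemma ring_autMV : right_inverse ring_aut1 ring_autV ring_autM.
Proof.
move=> f; apply: ring_autP => x /=.
by rewrite /ring_autV; case: cid => g [/= _ gK]; apply: gK.
Qed.

End RingAutGroup.

HB.instance Definition _ (R : nzRingType) :=
  isGroup.Build (ring_aut R) (@ring_autMA R) (@ring_aut1M R) (@ring_autM1 R)
    (@ring_autVM R) (@ring_autMV R).

Definition perm_clus (n : nat) (s : 'S_n) (x : cluster n) : cluster n :=
  [ffun i => x (s^-1%g i)].

(* The default value [0] is never used on clusters [x] of the pattern or on
   their mutations, by [clus_in_alg] and [mut_clus_in_alg]. *)
Definition app_clus (n : nat) (S : cluster_pattern n)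
    (f : ring_aut (cluster_alg S)) (x : cluster n) : cluster n :=
  [ffun i => val (f (insubd 0 (x i)))].

Definition cluster_automorphism (n : nat) (S : cluster_pattern n)
    (f : ring_aut (cluster_alg S)) : Prop :=
  exists (t t' : treeT n) (s : 'S_n),
    perm_clus s (app_clus f (clus (S t))) = clus (S t') /\
    forall k : 'I_n,
      perm_clus s (app_clus f (mut_clus k (S t))) = mut_clus (s k) (S t').

Definition cluster_aut (n : nat) (S : cluster_pattern n) :
    {pred ring_aut (cluster_alg S)} :=
  fun f => `[< cluster_automorphism f >].

Arguments cluster_aut {n} S f.

Definition gen_group (G : groupType) (X : {pred G}) : {pred G} :=
  fun g => `[< forall K : {pred G}, group_closed K ->
               {subset X <= K} -> g \in K >].

(* For a subset [H] of a group: being a subgroup with a finite generating set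
   is being equal to some [gen_group s]. *)
Definition finitely_generated (G : groupType) (H : {pred G}) : Prop :=
  exists s : seq G, H =i gen_group (mem s).

(* Main.v *)
(* Since the value of an exchange binomial at a cluster determines its two
   monomials up to order, an automorphism that maps a cluster and its
   mutations to a cluster and its mutations matches the exchange matrices up to
   a sign which is constant on connected components.  Such a matching is stable
   under mutation, so a cluster automorphism maps every cluster of the pattern
   to a cluster of the pattern, and cluster automorphisms form a group.
   Conversely two seeds with the same exchange matrix are related by a cluster
   automorphism.  Hence, if finitely many vertices [D] represent all exchange
   matrices, then the automorphisms from a vertex of [D] to a neighbour of a
   vertex of [D] carry [D] along every path of the tree; together with the
   automorphisms from the root to a vertex of [D], which are determined by that
   vertex and a permutation, they generate the group. *)
Require Import Defs.
From mathcomp Require Import all_boot all_algebra.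
From HB Require Import structures.
From mathcomp Require Import all_order all_fingroup fraction zify ring.
From mathcomp.multinomials Require Import mpoly.
From mathcomp.classical Require Import boolp classical_sets cardinality.

Set Implicit Arguments.
Unset Strict Implicit.
Unset Printing Implicit Defensive.

Import Order.TTheory GRing.Theory Num.Theory.
Local Open Scope ring_scope.

(** * Polynomials and exchange binomials evaluated at a cluster *)

Lemma ratfun_const_is_zmod_morphism n : zmod_morphism (@ratfun_const n).
Proof. by move=> a b; rewrite /ratfun_const !rmorphB. Qed.

Lemma ratfun_const_is_monoid_morphism n : monoid_morphism (@ratfun_const n).
Proof. by split=> [|a b]; rewrite /ratfun_const ?rmorph1 ?rmorphM. Qed.

HB.instance Definition _ n :=
  GRing.isZmodMorphism.Build rat (ratfun n) (@ratfun_const n)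
    (@ratfun_const_is_zmod_morphism n).
HB.instance Definition _ n :=
  GRing.isMonoidMorphism.Build rat (ratfun n) (@ratfun_const n)
    (@ratfun_const_is_monoid_morphism n).

Lemma alg_independent_inj n (x : cluster n) :
  alg_independent x -> injective (mmap (@ratfun_const n) x).
Proof.
by move=> xI p q pq; apply/subr0_eq/xI; rewrite rmorphB /= pq subrr.
Qed.

Lemma alg_independent_neq0 n (x : cluster n) i : alg_independent x -> x i != 0.
Proof.
move=> xI; apply/eqP => xi0; have := xI 'X_i.
rewrite mmapX mmap1U xi0 => /(_ erefl) /(congr1 (mcoeff U_(i))) /eqP.
by rewrite mcoeffX eqxx mcoeff0 oner_eq0.
Qed.

Lemma exprz_posp (R : unitRingType) (x : R) b : x ^ posp b = x ^+ `|posp b|%N.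
Proof.
by rewrite /posp; case: (lerP b 0) => [|/ltW] // b0; rewrite -{1}(gez0_abs b0).
Qed.

Lemma pospBN b : posp b - posp (- b) = b.
Proof. rewrite /posp; lia. Qed.

Lemma mpolyX_inj n : injective (fun m : 'X_{1..n} => 'X_[m] : {mpoly rat[n]}).
Proof.
move=> a b /= /(congr1 (mcoeff a)); rewrite !mcoeffX eqxx.
by have [->|_ /eqP] := eqVneq b a; rewrite // oner_eq0.
Qed.

(** The coefficient of ['X_[a]] on the left is 1 or 2, nonzero in characteristic 0, so [a] occurs on
    the right; the other two monomials agree by cancellation. *)
Lemma mpolyXD_inj n (a b c d : 'X_{1..n}) :
  'X_[a] + 'X_[b] = 'X_[c] + 'X_[d] :> {mpoly rat[n]} ->
  (a = c /\ b = d) \/ (a = d /\ b = c).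
Proof.
move=> E; have [ac|ac] := eqVneq a c.
  by left; split=> //; move: E; rewrite ac => /addrI /mpolyX_inj.
have ad : a = d.
  have := congr1 (mcoeff a) E; rewrite !mcoeffD !mcoeffX eqxx [c == a]eq_sym.
  rewrite (negPf ac) add0r; have [->//|_] := eqVneq d a.
  by case: (b == a).
by right; split=> //; move: E; rewrite ad [RHS]addrC => /addrI /mpolyX_inj.
Qed.

(** Natural exponents let it be formed in any commutative ring, in particular in the cluster
    algebra, where cluster variables need not be invertible. *)
Definition exchange_binomial n (R : comNzRingType) (x : 'I_n -> R)
    (b : 'I_n -> int) : R :=
  \prod_j x j ^+ `|posp (b j)| + \prod_j x j ^+ `|posp (- b j)|.

(** Independence lifts the equality to polynomials, whose monomials then agree up to order; their
    exponents are the positive and negative parts of the entries. *)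
Lemma exchange_binomial_inj n (x : cluster n) (b b' : 'I_n -> int) :
  alg_independent x -> exchange_binomial x b = exchange_binomial x b' ->
  exists e : bool, forall j, b' j = (-1) ^+ e * b j.
Proof.
move=> /alg_independent_inj xI.
pose m (c : 'I_n -> int) := [multinom `|posp (c j)|%N | j < n].
have ev c : exchange_binomial x c
    = mmap (@ratfun_const n) x ('X_[m c] + 'X_[m (fun j => - c j)]).
  rewrite rmorphD /= !mmapX /mmap1 /exchange_binomial.
  by congr (_ + _); apply: eq_bigr => j _; rewrite mnmE.
have mE c c' : m c = m c' -> forall j, posp (c j) = posp (c' j).
  move=> /mnmP + j => /(_ j); rewrite !mnmE /posp; lia.
rewrite !ev => /xI /mpolyXD_inj [[/mE E1 /mE E2]|[/mE E1 /mE E2]].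
  exists false => j; rewrite expr0 mul1r.
  by rewrite -[LHS]pospBN -[RHS]pospBN E1 E2.
exists true => j; rewrite expr1 mulN1r.
by rewrite -[b' j]pospBN -[in RHS](pospBN (b j)) E1 E2 opprB.
Qed.

Lemma exchange_binomial_sign n (R : comNzRingType) (x : 'I_n -> R)
    (b : 'I_n -> int) (e : bool) :
  exchange_binomial x (fun j => (-1) ^+ e * b j) = exchange_binomial x b.
Proof.
rewrite /exchange_binomial; case: e; last first.
  by under eq_bigr do rewrite expr0 mul1r;
    under [X in _ + X]eq_bigr do rewrite expr0 mul1r.
rewrite addrC; congr (_ + _); apply: eq_bigr => j _;
  by rewrite expr1 mulN1r ?opprK.
Qed.

(** * Matching exchange matrices up to signs constant on connected components *)

Definition sign_equiv n (s : 'S_n) (B B' : 'M[int]_n) : Prop :=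
  exists2 e : 'I_n -> bool,
    forall i j, B' (s i) (s j) = (-1) ^+ e j * B i j
    & forall i j, B i j != 0 -> e i = e j.

Lemma sign_equiv_refl n (B : 'M[int]_n) : sign_equiv 1 B B.
Proof. by exists (fun=> false) => // i j; rewrite !perm1 mul1r. Qed.

Lemma sign_equiv_sym n s (B B' : 'M[int]_n) :
  sign_equiv s B B' -> sign_equiv s^-1 B' B.
Proof.
move=> [e BE eC].
have BE' i j :
    B' i j = (-1) ^+ e (s^-1%g j) * B (s^-1%g i) (s^-1%g j).
  by rewrite -BE !permKV.
exists (fun j => e (s^-1%g j)) => i j; first by rewrite BE' signrMK.
by rewrite BE' mulf_eq0 signr_eq0 => /eC.
Qed.

Lemma sign_equiv_trans n s s' (B B' B'' : 'M[int]_n) :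
  sign_equiv s B B' -> sign_equiv s' B' B'' -> sign_equiv (s * s')%g B B''.
Proof.
move=> [e BE eC] [e' BE' eC']; exists (fun j => e j (+) e' (s j)) => i j.
  by rewrite !permM BE' BE mulrA addbC signr_addb.
move=> Bij; rewrite (eC _ _ Bij); congr (_ (+) _); apply: eC'.
by rewrite BE mulf_eq0 signr_eq0.
Qed.

(** The correction to an entry [i j] is nonzero only if [B i k] and [B k j] are, and then [e] agrees
    at [i], [k] and [j]. So mutation joins no two components, and only a common sign has to pass
    through it. *)
Lemma sign_equiv_mut n s (B B' : 'M[int]_n) k :
  sign_equiv s B B' -> sign_equiv s (mut_exmx k B) (mut_exmx (s k) B').
Proof.
move=> [e BE eC]; exists e => i j; rewrite !mxE ?(inj_eq perm_inj).
  case: ifP => _; first by rewrite BE mulrN.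
  rewrite !BE; have [Bik|/eC ei] := eqVneq (B i k) 0.
    by rewrite Bik mulr0 oppr0 /posp !mul0r !addr0.
  have [Bkj|/eC ek] := eqVneq (B k j) 0.
    by rewrite Bkj mulr0 /posp !mulr0 !addr0.
  rewrite ek; case: (e j); rewrite ?expr1 ?expr0 ?mul1r // !mulN1r opprK.
  (* The correction expands to [p * p' - q * q']; negating the matrix swaps [p] with [q] and [p']
     with [q']. *)
  have := pospBN (B i k); have := pospBN (B k j).
  set p := posp (B i k); set q := posp (- B i k).
  set p' := posp (B k j); set q' := posp (- B k j).
  by move=> <- <-; ring.
case: ifP => _; first by rewrite oppr_eq0 => /eC.
have [/eC //|Bij] := boolP (B i j != 0).
move/negPn/eqP: Bij => ->; rewrite add0r.
have [->|/eC ->] := eqVneq (B i k) 0; first by rewrite oppr0 /posp !mul0r addr0.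
have [->|/eC ->//] := eqVneq (B k j) 0.
by rewrite /posp !mulr0 addr0.
Qed.

Lemma skew_symmetrizableP n (B : 'M[int]_n) : skew_symmetrizable B ->
  exists2 d : 'I_n -> int, forall i, 0 < d i
    & forall i j, d i * B i j = - (d j * B j i).
Proof.
move=> [d [d0 dB]]; exists (d 0) => // i j.
by move/matrixP/(_ j i): dB; rewrite [in LHS]mxE [in RHS]mxE mul_diag_mx !mxE => ->.
Qed.

(* If column [j] changes sign and column [i] does not, then [b_ij] and [b_ji]
   have opposite signs in [B] but equal signs in [B']. *)
Lemma skew_symmetrizable_sign_equiv n (s : 'S_n) (B B' : 'M[int]_n) :
  skew_symmetrizable B -> skew_symmetrizable B' ->
  (forall j, exists e : bool, forall i, B' (s i) (s j) = (-1) ^+ e * B i j) ->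
  sign_equiv s B B'.
Proof.
move=> /skew_symmetrizableP[d d0 dB] /skew_symmetrizableP[d' d0' dB'].
move=> /choice[e BE]; exists e => // i j Bij.
have := dB' (s i) (s j); rewrite !BE => H'; have H := dB i j.
have {}H' : (-1) ^+ (e i (+) e j) * (d' (s i) * B i j) = - (d' (s j) * B j i).
  move: H'; rewrite signr_addb -mulrA => /(congr1 (fun z => (-1) ^+ e i * z)).
  rewrite mulrN (mulrCA (d' (s j))) signrMK => <-.
  by rewrite (mulrCA (d' (s i))).
apply/eqP; rewrite -negb_add; apply/negP => De.
move: H' (d0 i) (d0 j) (d0' (s i)) (d0' (s j)); rewrite De expr1 mulN1r.
move=> /oppr_inj H' ? ? ? ?; have [Bp|Bn|B0] := ltrgt0P (B i j).
- have : 0 < d i * B i j by rewrite mulr_gt0.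
  have : 0 < d' (s i) * B i j by rewrite mulr_gt0.
  by rewrite H H' pmulr_rgt0 // oppr_gt0 pmulr_rlt0 // => /lt_gtF ->.
- have : d i * B i j < 0 by rewrite pmulr_rlt0.
  have : d' (s i) * B i j < 0 by rewrite pmulr_rlt0.
  by rewrite H H' pmulr_rlt0 // oppr_lt0 pmulr_rgt0 // => /lt_gtF ->.
- by rewrite B0 in Bij.
Qed.

(** * Substituting one cluster for another in rational functions *)

Lemma subf_div (F : fieldType) (a c b d : F) : b != 0 -> d != 0 ->
  a / b - c / d = (a * d - c * b) / (b * d).
Proof. by move=> b0 d0; rewrite -mulNr addf_div // mulNr. Qed.

(** Such quotients form a subfield containing [x], since independence keeps products of denominators
    nonzero. *)
Lemma generates_field_quotient n (x : cluster n) :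
  alg_independent x -> generates_field x -> forall z, exists pq,
    pq.2 != 0 /\ z = mmap (@ratfun_const n) x pq.1 / mmap (@ratfun_const n) x pq.2.
Proof.
move=> xI xG z; pose ev := mmap (@ratfun_const n) x.
pose K : {pred ratfun n} :=
  fun z => `[< exists pq, pq.2 != 0 /\ z = ev pq.1 / ev pq.2 >].
suff : z \in K by move/asboolP.
have ev0 q : q != 0 -> ev q != 0 by apply: contra_neq => /xI.
apply: xG => [|i]; last first.
  apply/asboolP; exists ('X_i, 1).
  by rewrite oner_neq0 /ev rmorph1 divr1 mmapX mmap1U.
split=> [|u v /asboolP[[p q] /= [q0 ->]] /asboolP[[p' q'] /= [q0' ->]]|
  u v /asboolP[[p q] /= [q0 ->]] /asboolP[[p' q'] /= [q0' ->]]]; apply/asboolP.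
- by exists (1, 1); rewrite oner_neq0 /ev rmorph1 divr1.
- exists (p * q' - p' * q, q * q') => /=; split; first by rewrite mulf_neq0.
  rewrite /ev rmorphB !rmorphM /= -/ev.
  by rewrite subf_div ?ev0.
(* Closure under division includes division by 0, whose value is 0. *)
have [->|p0'] := eqVneq p' 0.
  by exists (0, 1); rewrite oner_neq0 /ev rmorph0 !mul0r invr0 mulr0.
exists (p * q', q * p') => /=; split; first by rewrite mulf_neq0.
by rewrite /ev !rmorphM /= -/ev invf_div mulf_div.
Qed.

(** A chosen quotient of polynomials at [x] is evaluated at [x']. The choice is harmless ([psiE]):
    equal quotients at [x] cross-multiply to a polynomial identity, which also holds at [x']. *)
Lemma ratfun_subst n (x x' : cluster n) :
  alg_independent x -> generates_field x -> alg_independent x' ->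
  exists psi : {rmorphism ratfun n -> ratfun n}, forall i, psi (x i) = x' i.
Proof.
move=> xI xG xI'; have /choice[pq pqP] := generates_field_quotient xI xG.
pose ev := mmap (@ratfun_const n) x; pose ev' := mmap (@ratfun_const n) x'.
have ev0 q : q != 0 -> ev q != 0 by apply: contra_neq => /xI.
have ev0' q : q != 0 -> ev' q != 0 by apply: contra_neq => /xI'.
pose psi z := ev' (pq z).1 / ev' (pq z).2.
have psiE p q : q != 0 -> psi (ev p / ev q) = ev' p / ev' q.
  move=> q0; rewrite /psi; set z := ev p / ev q; have [d0 zE] := pqP z.
  apply/eqP; rewrite eqr_div ?ev0' // /ev' -!rmorphM /= -/ev'; apply/eqP.
  congr (ev' _); apply: (alg_independent_inj xI); rewrite !rmorphM /= -/ev.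
  by apply/eqP; rewrite -eqr_div ?ev0 // -zE.
have psiB : zmod_morphism psi.
  move=> u v; have [d0 ->] := pqP u; have [d0' ->] := pqP v.
  rewrite -!/ev !psiE // (subf_div _ _ (ev0 _ d0) (ev0 _ d0')).
  rewrite (subf_div _ _ (ev0' _ d0) (ev0' _ d0')).
  by rewrite /ev /ev' -!rmorphM -!rmorphB /= psiE // mulf_neq0.
have psiM : monoid_morphism psi.
  split=> [|u v].
    have := psiE 1 1 (oner_neq0 _).
    by rewrite /ev /ev' !rmorph1 !divr1.
  have [d0 ->] := pqP u; have [d0' ->] := pqP v.
  rewrite -!/ev !psiE // !mulf_div.
  by rewrite /ev /ev' -!rmorphM /= psiE // mulf_neq0.
pose gA := GRing.isZmodMorphism.Build _ _ psi psiB.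
pose gR := GRing.isMonoidMorphism.Build _ _ psi psiM.
pose psi' : {rmorphism ratfun n -> ratfun n} := HB.pack psi gA gR.
exists psi' => i; have := psiE 'X_i 1 (oner_neq0 _).
by rewrite /ev /ev' !rmorph1 !divr1 !mmapX !mmap1U.
Qed.

(** * Exchange relations under ring maps and permutations *)

Lemma rmorph_exchange_binomial n (R R' : comNzRingType)
    (g : {rmorphism R -> R'}) (x : 'I_n -> R) (b : 'I_n -> int) :
  g (exchange_binomial x b) = exchange_binomial (fun i => g (x i)) b.
Proof.
rewrite rmorphD !rmorph_prod.
by congr (_ + _); apply: eq_bigr => j _; rewrite rmorphXn.
Qed.

Lemma eq_exchange_binomial n (R : comNzRingType) (x x' : 'I_n -> R)
    (b b' : 'I_n -> int) :
  x =1 x' -> b =1 b' -> exchange_binomial x b = exchange_binomial x' b'.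
Proof. by move=> /funext -> /funext ->. Qed.

Lemma exchange_binomial_perm n (R : comNzRingType) (s : 'S_n) (x : 'I_n -> R)
    (b : 'I_n -> int) :
  exchange_binomial (fun i => x (s i)) (fun i => b (s i))
  = exchange_binomial x b.
Proof.
by rewrite /exchange_binomial; congr (_ + _); symmetry;
  rewrite (reindex_inj (@perm_inj _ s)).
Qed.

Lemma mut_clusE n (Sg : seed n) k : alg_independent (clus Sg) ->
  mut_clus k Sg k * clus Sg k
  = exchange_binomial (clus Sg) (fun j => exmx Sg j k).
Proof.
move=> xI; rewrite /mut_clus ffunE eqxx mulrC mulrA divff ?mul1r; last first.
  exact: alg_independent_neq0.
by congr (_ + _); apply: eq_bigr => j _; rewrite exprz_posp.
Qed.

(** * Induction along the edges of the tree *)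

Lemma tedge_sym n (k : 'I_n) t u : tedge k t u = tedge k u t.
Proof. by rewrite /tedge orbC. Qed.

(** Deleting letters joins every word to the empty one, and edges are symmetric, so [P] passes from
    [t0] to the root and on to [u]. *)
Lemma treeT_ind n (P : treeT n -> Prop) t0 : P t0 ->
  (forall k t u, tedge k t u -> P t -> P u) -> forall u, P u.
Proof.
move=> P0 Pe; pose root : treeT n := Sub [::] isT.
have up w : forall wP : reduced w, P root <-> P (Sub w wP).
  elim: w => [|k w IH] wP; first by rewrite (bool_irrelevance wP isT).
  have wP' : reduced w by apply: path_sorted wP.
  rewrite (IH wP').
  have e : tedge k (Sub w wP' : treeT n) (Sub (k :: w) wP).
    by rewrite /tedge /= eqxx.
  by split; apply: (Pe k); rewrite // tedge_sym.
case=> u uP; apply/(up u uP).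
by case: t0 P0 => v vP /(up v vP).
Qed.

(** * Ring maps carrying seeds to seeds *)

Section Sends.
Variables (n : nat) (S : cluster_pattern n).
Implicit Types (t u : treeT n) (s : 'S_n).

Definition clus_var t i : cluster_alg S := ClusterAlg (clus_in_alg S t i).

(** The matrix condition replaces the one on mutated clusters. Values lie in the field so that [g]
    may be a substitution not yet known to preserve the algebra. *)
Definition sends (g : cluster_alg S -> ratfun n) s t t' : Prop :=
  (forall i, g (clus_var t i) = clus (S t') (s i)) /\
  sign_equiv s (exmx (S t)) (exmx (S t')).

Lemma seed_at_indep t : alg_independent (clus (S t)).
Proof. by case: (seed_atP S t). Qed.

Lemma seed_at_skew t : skew_symmetrizable (exmx (S t)).
Proof. by case: (seed_atP S t). Qed.

Lemma clus_var_edge k t u i : tedge k t u -> i != k ->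
  clus_var u i = clus_var t i.
Proof.
move=> tu ik; apply: val_inj => /=.
by rewrite (seed_at_edge S tu) /= ffunE (negPf ik).
Qed.

Lemma clus_var_exchange k t u : tedge k t u ->
  clus_var u k * clus_var t k
  = exchange_binomial (clus_var t) (fun j => exmx (S t) j k).
Proof.
move=> tu; apply: val_inj; rewrite rmorphM.
rewrite rmorph_exchange_binomial /= (seed_at_edge S tu) /=.
exact/mut_clusE/seed_at_indep.
Qed.

(** Only the variable [k] changes. Its image is forced by the exchange relation, whose binomial is
    unaffected by the sign of column [k]. *)
Lemma sends_edge (g : {rmorphism cluster_alg S -> ratfun n}) s k t t' u u' :
  sends g s t t' -> tedge k t u -> tedge (s k) t' u' -> sends g s u u'.
Proof.
move=> [gE se] tu tu'; split; last first.
  by rewrite (seed_at_edge S tu) (seed_at_edge S tu'); apply: sign_equiv_mut.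
move=> i; have [->|ik] := eqVneq i k; last first.
  rewrite (clus_var_edge tu ik) gE (seed_at_edge S tu') /= ffunE.
  by rewrite (inj_eq perm_inj) (negPf ik).
have x0 := alg_independent_neq0 (s k) (seed_at_indep (t := t')).
apply: (mulIf x0); rewrite -{1}gE -rmorphM (clus_var_exchange tu).
rewrite (seed_at_edge S tu') /= (mut_clusE _ (seed_at_indep (t := t'))).
have [e BE _] := se; rewrite rmorph_exchange_binomial -[RHS](exchange_binomial_perm s).
rewrite -(exchange_binomial_sign _ _ (e k)).
by apply: eq_exchange_binomial => j; rewrite ?gE ?BE.
Qed.

(** The path from [t] to [u] is copied from [t'] with its labels permuted by [s]. *)
Lemma sends_all (g : {rmorphism cluster_alg S -> ratfun n}) s t t' :
  sends g s t t' -> forall u, exists u', sends g s u u'.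
Proof.
move=> gt; apply: (treeT_ind (t0 := t)); first by exists t'.
move=> k v u vu [v' gv]; have [u' [vu' _]] := tedge_unique (s k) v'.
by exists u'; apply: sends_edge gv vu vu'.
Qed.

Lemma sends_var (f : ring_aut (cluster_alg S)) s t t' i :
  sends (val \o f) s t t' -> f (clus_var t i) = clus_var t' (s i).
Proof. by move=> [fE _]; apply: val_inj; rewrite -[LHS]/((val \o f) _) fE. Qed.

Lemma app_clus_var (f : ring_aut (cluster_alg S)) t i :
  app_clus f (clus (S t)) i = val (f (clus_var t i)).
Proof.
rewrite ffunE; congr (val (f _)); apply: val_inj.
by rewrite insubdK //; apply: clus_in_alg.
Qed.

Lemma cluster_automorphismP (f : ring_aut (cluster_alg S)) :
  cluster_automorphism f <-> exists t t' s, sends (val \o f) s t t'.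
Proof.
split=> [[t [t' [s [fE fmE]]]]|[t [t' [s ft]]]]; exists t, t', s; last first.
  have E u u' : sends (val \o f) s u u' ->
      perm_clus s (app_clus f (clus (S u))) = clus (S u').
    by move=> fu; apply/ffunP => i; rewrite ffunE app_clus_var (sends_var _ fu) permKV.
  split=> [|k]; first exact: E.
  have [u [tu _]] := tedge_unique k t.
  have [u' [tu' _]] := tedge_unique (s k) t'.
  have := sends_edge ft tu tu' => /E.
  by rewrite (seed_at_edge S tu) (seed_at_edge S tu').
have gE i : val (f (clus_var t i)) = clus (S t') (s i).
  by rewrite -fE ffunE app_clus_var permK.
split=> //; apply: skew_symmetrizable_sign_equiv; try exact: seed_at_skew.
move=> k; have [u [tu _]] := tedge_unique k t.
(* Multiplying by the old variable turns the condition on mutated clusters into an equality of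
   exchange binomials at the cluster of [t'], which fixes column [k] up to sign. *)
have := congr1 (fun x : cluster n => x (s k) * clus (S t') (s k)) (fmE k).
rewrite mut_clusE; last exact: seed_at_indep.
have -> : mut_clus k (S t) = clus (S u) by rewrite (seed_at_edge S tu).
rewrite ffunE app_clus_var permK -gE -!rmorphM (clus_var_exchange tu).
rewrite !rmorph_exchange_binomial => H.
have /exchange_binomial_inj := seed_at_indep (t := t').
move/(_ (fun i => exmx (S t) (s^-1%g i) k) (fun j => exmx (S t') j (s k))).
case=> [|e eE]; last by exists e => i; rewrite eE permK.
rewrite -H -(exchange_binomial_perm s).
by apply: eq_exchange_binomial => i; [rewrite -gE | rewrite permK].
Qed.

Lemma sends1 t : sends val 1 t t.
Proof. by split=> [i|]; rewrite ?perm1 //; apply: sign_equiv_refl. Qed.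

(** Automorphisms compose from right to left, permutations from left to right. *)
Lemma sendsM (f g : ring_aut (cluster_alg S)) s s' t t' t'' :
  sends (val \o f) s t t' -> sends (val \o g) s' t' t'' ->
  sends (val \o (g * f)%g) (s * s') t t''.
Proof.
move=> ft gt; split; last by apply: sign_equiv_trans; [apply: ft.2|apply: gt.2].
by move=> i; rewrite permM -gt.1 /= (sends_var _ ft).
Qed.

Lemma sendsV (f : ring_aut (cluster_alg S)) s t t' :
  sends (val \o f) s t t' -> sends (val \o f^-1%g) s^-1 t' t.
Proof.
move=> ft; split=> [i|]; last by apply: sign_equiv_sym; apply: ft.2.
have -> : clus_var t' i = f (clus_var t (s^-1%g i)).
  by rewrite (sends_var _ ft) permKV.
have : (f^-1 * f)%g (clus_var t (s^-1%g i)) = clus_var t (s^-1%g i).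
  by rewrite mulVg.
by move=> /(congr1 val).
Qed.

Lemma cluster_aut_group_closed : group_closed (cluster_aut S).
Proof.
split=> [|f g /asboolP/cluster_automorphismP[t [t' [s ft]]]].
  apply/asboolP/cluster_automorphismP.
  by exists (Sub [::] isT), (Sub [::] isT), 1%g; apply: sends1.
move=> /asboolP/cluster_automorphismP[u [u' [s' /sendsV gu]]].
apply/asboolP/cluster_automorphismP.
(* The witness of [f] is moved to start at [u], where [g^-1] arrives. *)
have [v fv] := sends_all ft u.
by exists u', v, (s'^-1 * s)%g; apply: sendsM gu fv.
Qed.

Lemma cluster_alg_ind (P : ratfun n -> Prop) :
  P 1 -> (forall z z', P z -> P z' -> P (z - z')) ->
  (forall z z', P z -> P z' -> P (z * z')) ->
  (forall t i, P (clus (S t) i)) -> forall z, z \in cluster_alg_pred S -> P z.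
Proof.
move=> P1 PB PM Px y /asboolP yA; pose K : {pred ratfun n} := fun z => `[< P z >].
have K_ring : subring_closed K.
  split=> [|z z' /asboolP Pz /asboolP Pz'|z z' /asboolP Pz /asboolP Pz'].
  - exact/asboolP.
  - exact/asboolP/PB.
  - exact/asboolP/PM.
have /asboolP // : y \in K.
by apply: yA => // t i; apply/asboolP.
Qed.

(* The elements [u / v] with [u, v] in the algebra on which [f] and [g] agree
   form a subfield containing the cluster at [t]. *)
Lemma rmorph_clus_var_inj (f g : {rmorphism cluster_alg S -> cluster_alg S}) t :
  injective g -> (forall i, f (clus_var t i) = g (clus_var t i)) -> f =1 g.
Proof.
move=> g_inj fg a.
pose K : {pred ratfun n} := fun z => `[< exists u v : cluster_alg S,
  [/\ val v != 0, z = val u / val v, f u = g u & f v = g v] >].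
have valM (u v : cluster_alg S) : val (u * v) = val u * val v by exact: rmorphM.
have valB (u v : cluster_alg S) : val (u - v) = val u - val v by exact: rmorphB.
have : val a \in K.
  have [_ xG _] := seed_atP S t; apply: xG => [|i]; last first.
    apply/asboolP; exists (clus_var t i), 1.
    by rewrite fg !rmorph1 divr1; split; first exact: oner_neq0.
  split=> [|z z' /asboolP[u [v [v0 -> fu fv]]] /asboolP[u' [v' [v0' -> fu' fv']]]|
    z z' /asboolP[u [v [v0 -> fu fv]]] /asboolP[u' [v' [v0' -> fu' fv']]]];
    apply/asboolP.
  - by exists 1, 1; rewrite !rmorph1 divr1; split; first exact: oner_neq0.
  - exists (u * v' - u' * v), (v * v').
    split; rewrite ?valM.
    + exact: (mulf_neq0 v0 v0').
    + by rewrite valB !valM (subf_div _ _ v0 v0').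
    + by rewrite !rmorphB !rmorphM fu fu' fv fv'.
    + by rewrite !rmorphM fv fv'.
  have [u0'|u0'] := eqVneq (val u') 0.
    exists 0, 1; rewrite u0' mul0r invr0 mulr0 !rmorph0 !rmorph1 mul0r.
    by split; first exact: oner_neq0.
  exists (u * v'), (v * u'); split; rewrite ?valM.
  - exact: (mulf_neq0 v0 u0').
  - by rewrite invf_div mulf_div.
  - by rewrite !rmorphM fu fv'.
  - by rewrite !rmorphM fv fu'.
move=> /asboolP[u [v [v0 av fu fv]]].
have {}av : a * v = u by apply: val_inj; rewrite valM av divfK.
(* Injectivity of [g] keeps the common value of [f v] and [g v] nonzero, so it can be cancelled. *)
have fv0 : val (f v) != 0.
  apply: contra_neq v0 => fv0; have -> // : v = 0.
  by apply/g_inj/val_inj; rewrite -fv fv0 rmorph0.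
apply: val_inj; apply: (mulIf fv0); rewrite -valM -rmorphM av fu.
by rewrite fv -valM -rmorphM av.
Qed.

Lemma sends_inj (f g : ring_aut (cluster_alg S)) s t t' :
  sends (val \o f) s t t' -> sends (val \o g) s t t' -> f = g.
Proof.
move=> ft gt; apply/ring_autP/(@rmorph_clus_var_inj _ _ t).
  exact/bij_inj/ring_aut_bij.
by move=> i; rewrite (sends_var _ ft) (sends_var _ gt).
Qed.

(** The field substitution maps every cluster of the pattern to a cluster by [sends_all], hence
    preserves the algebra. The reverse substitution inverts it on a cluster, hence everywhere. *)
Lemma sends_exists t t' : exmx (S t) = exmx (S t') ->
  exists f : ring_aut (cluster_alg S), sends (val \o f) 1 t t'.
Proof.
have ext u u' : exmx (S u) = exmx (S u') ->
    exists f : {rmorphism cluster_alg S -> cluster_alg S},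
      forall i, f (clus_var u i) = clus_var u' i.
  move=> Buu'; have [xI xG _] := seed_atP S u.
  have [psi psiE] := ratfun_subst xI xG (seed_at_indep (t := u')).
  have psi_u : sends (psi \o val) 1 u u'.
    split=> [i|]; first by rewrite perm1 /= psiE.
    by rewrite Buu'; apply: sign_equiv_refl.
  have psiA (a : cluster_alg S) : psi (val a) \in cluster_alg_pred S.
    have := clalg_valP a; apply: (@cluster_alg_ind (fun z => psi z \in _)).
    - by rewrite rmorph1 rpred1.
    - by move=> z z' zA zA'; rewrite rmorphB rpredB.
    - by move=> z z' zA zA'; rewrite rmorphM rpredM.
    - move=> v i; have [v' [gE _]] := sends_all psi_u v.
      by rewrite -[psi _]/((psi \o val) (clus_var v i)) gE clus_in_alg.
  pose f a := ClusterAlg (psiA a).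
  have fB : zmod_morphism f by move=> a b; apply: val_inj; rewrite /= !rmorphB.
  have fM : monoid_morphism f.
    by split=> [|a b]; apply: val_inj; rewrite /= ?rmorph1 ?rmorphM.
  pose fA := GRing.isZmodMorphism.Build _ _ f fB.
  pose fR := GRing.isMonoidMorphism.Build _ _ f fM.
  pose f' : {rmorphism cluster_alg S -> cluster_alg S} := HB.pack f fA fR.
  by exists f' => i; apply: val_inj; rewrite /= psiE.
move=> Btt'; have [f fE] := ext _ _ Btt'; have [g gE] := ext _ _ (esym Btt').
have fK : cancel f g.
  apply: (@rmorph_clus_var_inj (g \o f) idfun t) => [? ? //|i].
  by rewrite /= fE gE.
have gK : cancel g f.
  apply: (@rmorph_clus_var_inj (f \o g) idfun t') => [? ? //|i].
  by rewrite /= gE fE.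
exists (RingAut (Bijective fK gK)); split=> [i|]; first by rewrite perm1 /= fE.
by rewrite Btt'; apply: sign_equiv_refl.
Qed.
End Sends.

(** * Finitely many representatives and the generating set *)

Lemma finite_mutation_type_reps n (S : cluster_pattern n) :
  finite_mutation_type S ->
  exists D : seq (treeT n), forall t, exists2 d, d \in D & exmx (S d) = exmx (S t).
Proof.
move=> /finite_seqP[Bs BsE].
have [r rP] : exists r : 'M[int]_n -> treeT n,
    forall t, exmx (S (r (exmx (S t)))) = exmx (S t).
  have /choice[r rP] (B : 'M[int]_n) :
      exists u, forall t, exmx (S t) = B -> exmx (S u) = B.
    have [[t tB]|nB] := pselect (exists t, exmx (S t) = B); first by exists t.
    (* The root is a dummy value for matrices that do not occur. *)
    by exists (Sub [::] isT) => t tB; case: nB; exists t.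
  by exists r => t; apply: rP erefl.
exists [seq r B | B <- Bs] => t; exists (r (exmx (S t))); last exact: rP.
apply: map_f.
have : [set exmx (S t) | t in [set: treeT n]]%classic (exmx (S t)) by exists t.
by rewrite BsE.
Qed.

Theorem theorem3p2 (n : nat) (hn : (1 <= n)%N) (S : cluster_pattern n)
    (hfin : finite_mutation_type S) :
  finitely_generated (cluster_aut S).
Proof.
have [D DP] := finite_mutation_type_reps hfin.
have [r rD rE] : exists2 r : treeT n -> treeT n,
    forall t, r t \in D & forall t, exmx (S (r t)) = exmx (S t).
  have /choice[r rP] (t : treeT n) : exists d, d \in D /\ exmx (S d) = exmx (S t).
    by have [d dD dE] := DP t; exists d.
  by exists r => t; case: (rP t).
have /choice[step stepP] t := sends_exists (rE t).
have /choice[nb nbP] (dk : treeT n * 'I_n) : exists u, tedge dk.2 dk.1 u.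
  by have [u [? _]] := tedge_unique dk.2 dk.1; exists u.
pose root : treeT n := Sub [::] isT.
(* By [sends_inj] at most one automorphism fits [ds]; the identity is a dummy when there is none. *)
have /choice[sym symP] (ds : treeT n * 'S_n) :
    exists f : ring_aut (cluster_alg S), cluster_automorphism f /\
      forall g : ring_aut (cluster_alg S), sends (val \o g) ds.2 root ds.1 -> g = f.
  have [[f fP]|nf] := pselect (exists f : ring_aut (cluster_alg S),
      sends (val \o f) ds.2 root ds.1).
    exists f; split; last by move=> g gP; apply: sends_inj gP fP.
    by apply/cluster_automorphismP; exists root, ds.1, ds.2.
  exists 1%g; split; last by move=> g gP; case: nf; exists g.
  by apply/cluster_automorphismP; exists root, root, 1%g; apply: sends1.
(* [step root] starts the paths, [step (nb (d, k))] crosses an edge, and [sym (d, s)] accounts for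
   the permutation. *)
pose gens := step root :: [seq step (nb (d, k)) | d <- D, k <- enum 'I_n]
  ++ [seq sym (d, s) | d <- D, s <- enum [set: 'S_n]].
exists gens => f; apply/idP/asboolP => [/asboolP/cluster_automorphismP|]; last first.
  apply; first exact: cluster_aut_group_closed.
  have step_aut t : step t \in cluster_aut S.
    by apply/asboolP/cluster_automorphismP; exists (r t), t, 1%g.
  move=> g; rewrite inE mem_cat => /orP[/eqP ->//|/orP[]] /allpairsP[[d k] [_ _ ->]] //.
  by apply/asboolP; case: (symP (d, k)).
move=> [t [t' [s ft]]] K [K1 KB] genK.
have KV g : g \in K -> (g^-1)%g \in K by move=> gK; rewrite -div1g; apply: KB.
have KM g h : g \in K -> h \in K -> (g * h)%g \in K.
  by move=> gK hK; rewrite -[h]invgK; apply/KB/KV.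
have reach u : exists2 d, d \in D & exists2 g, g \in K & sends (val \o g) 1 d u.
  move: u; apply: (treeT_ind (t0 := root)).
    exists (r root) => //; exists (step root) => //.
    by apply: genK; rewrite mem_head.
  (* [g] takes the neighbour [nb (d, k)] of [d] to [v], and [step] takes the representative of that
     neighbour to it; their product reaches [v] from [D]. *)
  move=> k u v uv [d dD [g gK gu]]; have dw := nbP (d, k).
  exists (r (nb (d, k))) => //; exists (g * step (nb (d, k)))%g.
    apply: (KM _ _ gK); apply: genK; rewrite inE mem_cat; apply/orP; right.
    apply/orP; left.
    by apply: (allpairs_f (fun d k => step (nb (d, k)))); rewrite ?mem_enum.
  rewrite -[1%g]mulg1; apply: sendsM (stepP _) _.
  by apply: (sends_edge gu dw); rewrite perm1.
(* [f] takes the root to [v] and [g] takes [d] to [v], so [g^-1 * f] takes the root to [d] with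
   permutation [s] and is [sym (d, s)]. *)
have [v fv] := sends_all ft root; have [d dD [g gK gv]] := reach v.
rewrite -[f](mulKVg g); apply: (KM _ _ gK); apply: genK.
have := sendsM fv (sendsV gv); rewrite invg1 mulg1 => /((symP (d, s)).2 _) ->.
rewrite inE mem_cat; apply/orP; right; apply/orP; right.
by apply: (allpairs_f (fun d s => sym (d, s))); rewrite ?mem_enum ?inE.
Qed.
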